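(* Let $\pi=\{\pi_\ell\}_{\ell\in\mathsf L}$ be a one-site specification. For each $\ell\in\mathsf L$ and $(x,y)\in X^2$ there exists a coupling $\varrho_\ell^{x,y}\in\mathcal C(\pi_\ell^x,\pi_\ell^y)$ such that: (a) for each $B\in\mathcal B(\Xi_\ell^2)$, the map $X^2\ni(x,y)\mapsto\varrho_\ell^{x,y}(B)$ is $\mathcal F_\ell^2$-measurable; (b) $$d(\pi_\ell^x,\pi_\ell^y)=\int_{\Xi^2}\upsilon(\xi,\eta)\,\varrho_\ell^{x,y}(d\xi,d\eta).$$
   Context: $\mathsf L$ is the countable vertex set of a simple connected graph. $(\Xi,\mathcal B(\Xi))$ is a standard Borel space, $\Xi_\ell$ ($\ell\in\mathsf L$) are copies of $\Xi$, and $X=\Xi^{\mathsf L}$ carries the product $\sigma$-field. $\mathcal P(E)$ denotes the set of probability measures on a measurable space $E$. $\mathcal F_\ell$ is the $\sigma$-field $\mathcal B(\Xi^{\mathsf L\setminus\{\ell\}})$, viewed as the sub-$\sigma$-field of $\mathcal B(X)$ generated by the coordinates $x_{\ell'}$, $\ell'\neq\ell$; $\mathcal F_\ell^2$ is the corresponding product $\sigma$-field on $X^2$. A one-site specification is a family $\pi=\{\pi_\ell\}_{\ell\in\mathsf L}$ with $\pi_\ell=\{\pi_\ell^x:x\in X\}\subset\mathcal P(\Xi_\ell)$ such that $x\mapsto\pi_\ell^x(A)$ is $\mathcal F_\ell$-measurable for each $A\in\mathcal B(\Xi_\ell)$. $\mathcal C(\sigma,\varsigma)$ is the set of couplings of $\sigma$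 and $\varsigma$, i.e. probability measures on the product space with first marginal $\sigma$ and second marginal $\varsigma$. $\upsilon(\xi,\eta)=0$ if $\xi=\eta$ and $1$ otherwise. $d(\sigma,\varsigma)=\sup_{A\in\mathcal B(\Xi)}|\sigma(A)-\varsigma(A)|$. *)

(* Defs.v *)
From HB Require Import structures.
From mathcomp Require Import all_boot all_order all_algebra.
From mathcomp Require Import all_classical all_reals all_analysis.
From mathcomp Require Import measurable_realfun.

Set Implicit Arguments.
Unset Strict Implicit.
Unset Printing Implicit Defensive.

Import Order.TTheory GRing.Theory Num.Theory.

Local Open Scope classical_set_scope.
Local Open Scope ring_scope.

Definition simple_graph (V : Type) (adj : rel V) : Prop :=
  symmetric adj /\ irreflexive adj.

Definition connected_graph (V : Type) (adj : rel V) : Prop :=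
  forall u v : V, exists2 p : seq V, path adj u p & last u p = v.

Definition borel (P : ptopologicalType) := g_sigma_algebraType (@open P).

(* Hausdorff makes the complete pseudometric of P a metric. *)
Definition polish (R : realType) (P : completePseudoMetricType R) : Prop :=
  hausdorff_space P /\ exists2 D : set P, countable D & dense D.

Definition standard_borel (R : realType) (d : measure_display)
    (T : measurableType d) : Prop :=
  exists2 P : completePseudoMetricType R, polish P &
    exists (f : T -> borel P) (g : borel P -> T),
      [/\ measurable_fun [set: T] f, measurable_fun [set: borel P] g,
          cancel f g & cancel g f].

Section one_site.
Context (L : Type) (d : measure_display) (Xi : measurableType d) (R : realType).

Definition offsite_cylinders (l : L) : set_system (L -> Xi) :=
  \bigcup_(l' in [set~ l])
    preimage_set_system [set: L -> Xi] (fun x => x l') measurable.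

(* The space X = Xi^L equipped with the sub-sigma-field F_l; the library's
   product structure on offsite l * offsite l is then F_l^2 on X^2. *)
Definition offsite (l : L) := g_sigma_algebraType (offsite_cylinders l).

Definition one_site_specification (pi_ : L -> (L -> Xi) -> probability Xi R)
    : Prop :=
  forall (l : L) (A : set Xi), measurable A ->
    measurable_fun [set: offsite l] (fun x : offsite l => pi_ l x A).

End one_site.

Section coupling.
Context (d : measure_display) (T : measurableType d) (R : realType).
Local Open Scope ereal_scope.

Definition is_coupling (P Q : probability T R)
    (rho : probability (T * T)%type R) : Prop :=
  (forall A : set T, measurable A -> rho (A `*` [set: T]) = P A) /\
  (forall A : set T, measurable A -> rho ([set: T] `*` A) = Q A).

Definition upsilon (xi eta : T) : R := (if xi == eta then 0 else 1)%R.

Definition tv_dist (P Q : probability T R) : \bar R :=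
  ereal_sup [set `|P A - Q A| | A in (measurable : set (set T))].

End coupling.

(* Main.v *)
(* Let H be a positive Hahn set of P - Q, let (P - Q)^+ and (P - Q)^- be the
   Jordan parts, of common mass t = d(P, Q), and let P /\ Q = P - (P - Q)^+.
   The coupling puts P /\ Q on the diagonal and adds
   t^-1 (P - Q)^+ \x (P - Q)^-, which does not charge the diagonal because the
   two factors live on H and on its complement. It depends measurably on (P, Q)
   because a standard Borel sigma-field is generated by a countable algebra G,
   so that (P - Q)^+ A is the supremum over B in G of P (A & B) - Q (A & B), a
   countable supremum of measurable functions. *)

Require Import Defs.
From HB Require Import structures.
From mathcomp Require Import all_boot all_order all_algebra.
From mathcomp Require Import all_classical all_reals all_analysis.
From mathcomp Require Import measurable_realfun lra.

Set Implicit Arguments.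
Unset Strict Implicit.
Unset Printing Implicit Defensive.

Import Order.TTheory GRing.Theory Num.Theory.
Import numFieldNormedType.Exports.
Local Open Scope classical_set_scope.
Local Open Scope ring_scope.

(** * The algebra of sets generated by a sequence *)

Section countable_algebra.
Context {T : Type} (U : nat -> set T).

(** Label 0 with one child codes a complement, any node with two children a union. All other nodes
    are junk and denote [set0]. *)
Fixpoint eval_tree (t : GenTree.tree nat) : set T :=
  match t with
  | GenTree.Leaf n => U n
  | GenTree.Node 0 [:: s] => ~` eval_tree s
  | GenTree.Node _ [:: s; t] => eval_tree s `|` eval_tree t
  | _ => set0
  end.

(* Set-algebra terms over the U n form a countType, so their values are
   enumerated by nat. *)
Definition generated_algebra (n : nat) : set T :=
  oapp eval_tree set0 (unpickle n).

Lemma generated_algebra_eval (t : GenTree.tree nat) :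
  exists n, generated_algebra n = eval_tree t.
Proof. by exists (pickle t); rewrite /generated_algebra pickleK. Qed.

Lemma generated_algebra_ind (P : set_system T) :
  P set0 -> (forall n, P (U n)) -> (forall A, P A -> P (~` A)) ->
  (forall A B, P A -> P B -> P (A `|` B)) -> forall n, P (generated_algebra n).
Proof.
move=> P0 PU PC PUn n; rewrite /generated_algebra.
(* A raw structural fixpoint reaches the subtrees inside the list of children; only lists of length
   one or two matter. *)
case: unpickle => //= t; move: t; fix IH 1 => -[//|k s].
case: k => [|k]; case: s => [//|s1 [|s2 [|]]] //=.
- by apply: PC; exact: IH.
- by apply: PUn; exact: IH.
- by apply: PUn; exact: IH.
Qed.

Lemma generated_algebra_base n : exists m, generated_algebra m = U n.
Proof. exact: (generated_algebra_eval (GenTree.Leaf n)). Qed.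

Lemma generated_algebraC n :
  exists m, generated_algebra m = ~` generated_algebra n.
Proof.
rewrite {2}/generated_algebra; case: unpickle => [t|].
  exact: (generated_algebra_eval (GenTree.Node 0 [:: t])).
(* An index that decodes to no tree has value [set0]; the childless inner node is a code of [set0],
   so its complement has a code too. *)
have [m Em] := generated_algebra_eval (GenTree.Node 0 [::GenTree.Node 0 [::]]).
by exists m; rewrite Em.
Qed.

Lemma generated_algebraU n1 n2 :
  exists m, generated_algebra m = generated_algebra n1 `|` generated_algebra n2.
Proof.
rewrite {2 3}/generated_algebra; case: unpickle => [t1|]; last first.
  by exists n2; rewrite /= set0U.
case: (unpickle n2) => [t2|]; last first.
  by have [m Em] := generated_algebra_eval t1; exists m; rewrite /= setU0.
exact: (generated_algebra_eval (GenTree.Node 1 [:: t1; t2])).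
Qed.

End countable_algebra.

(** * Approximation of measurable sets by the generating algebra *)

Section approximation.
Context {d : measure_display} {T : measurableType d} {R : realType}.
Context (U : nat -> set T).
Hypothesis mU : forall n, measurable (U n).
Let G := generated_algebra U.

Lemma measurable_generated_algebra n : measurable (G n).
Proof.
apply: generated_algebra_ind => //.
- by move=> A; exact: measurableC.
- by move=> A B; exact: measurableU.
Qed.

Context (mu : {finite_measure set T -> \bar R}).
Local Open Scope ereal_scope.

Let fmu A : measurable A -> mu A \is a fin_num.
Proof. by move=> mA; rewrite fin_num_measure. Qed.

(** [A] lies in the closure of the algebra for the pseudometric given by the [mu]-mass of the
    symmetric difference. *)
Let approx (A : set T) := forall e : R, (0 < e)%R ->
  exists n, mu (A `\` G n) + mu (G n `\` A) < e%:E.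

(** Complementation exchanges the two halves of a symmetric difference. *)
Let approxC A : approx A -> approx (~` A).
Proof.
move=> aA e /aA[n ne]; have [m Gm] := generated_algebraC U n.
exists m; rewrite /G Gm !setDE !setCK addeC.
by rewrite setIC [X in _ + mu X]setIC -!setDE.
Qed.

Let approxU A B : measurable A -> measurable B ->
  approx A -> approx B -> approx (A `|` B).
Proof.
move=> mA mB aA aB e e0.
have e20 : (0 < e / 2)%R by rewrite divr_gt0.
have [m me] := aA _ e20; have [n ne] := aB _ e20.
have [k Gk] := generated_algebraU U m n; exists k.
have mG := measurable_generated_algebra.
have mD (X Y : set T) : measurable X -> measurable Y -> measurable (X `\` Y).
  exact: measurableD.
rewrite [e]splitr EFinD; apply: le_lt_trans (lteD me ne).
rewrite addeACA; apply: leeD.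
- apply: le_trans (measureU2 _ _ _); [|exact: mD|exact: mD].
  apply: le_measure; rewrite ?inE; first by apply: mD => //; exact: measurableU.
    by apply: measurableU; exact: mD.
  by rewrite /G Gk => x [[]Ax /not_orP[]]; [left|right].
- apply: le_trans (measureU2 _ _ _); [|exact: mD|exact: mD].
  apply: le_measure; rewrite ?inE; first by apply: mD => //; exact: measurableU.
    by apply: measurableU; exact: mD.
  by rewrite /G Gk => x [[]Ax /not_orP[]]; [left|right].
Qed.

(** By continuity from below some finite union [F n] misses at most half of [e] of the whole union,
    and [F n] is approximated within the other half. *)
Let approx_bigcup (A : (set T)^nat) : (forall n, measurable (A n)) ->
  (forall n, approx (A n)) -> approx (\bigcup_n A n).
Proof.
move=> mA aA e e0.
have e20 : (0 < e / 2)%R by rewrite divr_gt0.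
(* With [n.+1] terms, [F 0] is [A 0], so the induction starts from an approximable set. *)
pose F n := \big[setU/set0]_(i < n.+1) A i.
have mF n : measurable (F n) by exact: bigsetU_measurable.
have aF n : approx (F n).
  elim: n => [|n IH].
    by rewrite /F big_ord_recl big_ord0 setU0; exact: aA.
  rewrite /F big_ord_recr; apply: approxU.
  - exact: mF.
  - exact: mA.
  - exact: IH.
  - exact: aA.
have mE : measurable (\bigcup_n A n) by exact: bigcup_measurable.
have FE : \bigcup_n F n = \bigcup_n A n.
  rewrite eqEsubset; split => [x [n _]|x [n _ Anx]].
    by rewrite /F -bigcup_mkord => -[i /= _ Aix]; exists i.
  by exists n => //; rewrite /F -bigcup_mkord; exists n => /=.
have FsubE n : F n `<=` \bigcup_n A n by rewrite -FE; exact: bigcup_sup.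
have /= cF : mu (F n) @[n --> \oo] --> mu (\bigcup_n F n).
  apply: nondecreasing_cvg_mu => //; first by rewrite FE.
  apply/nondecreasing_seqP => n; apply/subsetPset.
  by rewrite /F [X in _ `<=` X]big_ord_recr; exact: subsetUl.
have [n ne] : exists n, mu ((\bigcup_n A n) `\` F n) < (e / 2)%:E.
  have : \forall n \near \oo, mu (\bigcup_n A n) - (e / 2)%:E < mu (F n).
    move: cF; rewrite FE -(fineK (fmu mE)) => /fine_cvgP[fin].
    move=> /cvgr_gt /(_ (fine (mu (\bigcup_n A n)) - e / 2)%R).
    rewrite ltrBlDr ltrDl => /(_ e20) lt; near=> k.
    rewrite -EFinB -(fineK (fmu (mF k))) lte_fin; near: k; exact: lt.
  move=> [n _ /(_ n (leqnn n))/= ne]; exists n.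
  rewrite measureD //; last by rewrite ltey_eq fmu.
  rewrite setIidr //.
  by rewrite lteBlDr ?fmu // addeC -lteBlDr.
have [m me] := aF n _ e20; exists m.
rewrite [e]splitr EFinD; apply: le_lt_trans (lteD ne me).
have mG := measurable_generated_algebra.
(* What [G m] misses is missed by [F n] or lies in [F n] outside [G m]; what it has in excess is
   also in excess of the smaller set [F n]. *)
rewrite addeA; apply: leeD.
- apply: le_trans (measureU2 _ _ _); [|exact: measurableD|exact: measurableD].
  apply: le_measure; rewrite ?inE; first by apply: measurableD.
    by apply: measurableU; exact: measurableD.
  move=> x [Ax Gx]; have [Fx|Fx] := pselect (F n x); [by right|by left].
- apply: le_measure; rewrite ?inE; [exact: measurableD|exact: measurableD|].
  by apply: setDS.
Unshelve. all: by end_near. Qed.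

(** The measurable approximable sets form a sigma-algebra containing every [U n]. *)
Lemma generated_algebra_approx (A : set T) (e : R) :
  <<s range U>> A -> (0 < e)%R ->
  exists n, mu (A `\` G n) + mu (G n `\` A) < e%:E.
Proof.
have mG := measurable_generated_algebra.
have self n : approx (G n).
  by move=> r r0; exists n; rewrite setDv measure0 adde0 lte_fin.
suff : <<s range U>> `<=` [set A | measurable A /\ approx A].
  by move=> sub /sub[_]; exact.
apply: smallest_sub.
- split=> [|X [mX aX]|F aF].
  (* The algebra contains [set0] as the complement of the union of [G 0] and its complement. *)
  + split => // r r0; have [m Em] := generated_algebraC U 0.
    have [k Ek] := generated_algebraU U m 0.
    have [n En] := generated_algebraC U k; exists n.
    by rewrite /G En Ek Em setUC setUv setCT setDv measure0 adde0 lte_fin.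
  + by rewrite setTD; split; [exact: measurableC|exact: approxC].
  + split; first by apply: bigcup_measurable => n _; case: (aF n).
    by apply: approx_bigcup => n; case: (aF n).
- move=> _ [n _ <-]; split => //; have [m <-] := generated_algebra_base U n.
  exact: self.
Qed.

End approximation.

(** * Countable generation and separation in standard Borel spaces *)

Section standard_borel.
Context {R : realType}.

(** The base consists of balls around a dense sequence with radii [r n]. Interiors are taken because
    balls of a pseudometric type need not be open. *)
Lemma polish_countable_base (P : completePseudoMetricType R) : polish P ->
  exists2 V : nat -> set P, (forall n, open (V n)) &
    forall O p, open O -> O p -> exists n, V n p /\ V n `<=` O.
Proof.
(* An empty dense set is impossible since [P] has a point; otherwise [a] enumerates [D]. *)
move=> [hP [D /pfcard_geP[->|[a]] dD]].
  have p : P by exact: point.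
  by have := dD setT (ex_intro _ p I) openT => -[x []].
pose r n : R := n.+1%:R^-1.
exists (fun m => oapp (fun kn : nat * nat => (ball (a kn.1) (r kn.2))°) set0
  (unpickle m)).
  by move=> n; case: unpickle => [kn|]; [exact: open_interior|exact: open0].
move=> O p oO Op.
have /nbhs_ballP[e /= e0 peO] : nbhs p O by exact: open_nbhs_nbhs.
have [n re] : exists n, 0 + r n < e / 2.
  by apply: ltr_add_invr; rewrite divr_gt0.
rewrite add0r in re.
have r0 : 0 < r n by rewrite invr_gt0 ltr0n.
have r20 : 0 < r n / 2 by rewrite divr_gt0.
(* A centre within half of [r n] from [p] leaves [p] interior to its ball of radius [r n]; as [r n]
   is below [e / 2], that ball stays in the ball of radius [e] around [p]. *)
have [x [pbx Dx]] : (ball p (r n / 2))° `&` D !=set0.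
  apply: dD; last exact: open_interior.
  by exists p; exact: nbhsx_ballx.
have [k _ akx] : (a @` setT) x by exact: (@surj _ _ _ _ a).
have {}pbx : ball p (r n / 2) x by exact: interior_subset pbx.
exists (pickle (k, n)); rewrite pickleK /= akx; split.
- apply/nbhs_ballP; exists (r n / 2) => //= y py.
  by rewrite [r n]splitr; apply: ball_triangle py; exact: ball_sym.
- move=> y /interior_subset xy; apply: peO.
  apply: (@le_ball _ _ _ (r n / 2 + r n)); last exact: ball_triangle xy.
  rewrite [e]splitr lerD ?(ltW re)//.
  by rewrite (le_trans _ (ltW re)) // ler_pdivrMr // ler_peMr ?ler1n // ltW.
Qed.

(** The [U n] are preimages of a countable base under the Borel isomorphism. The last clause,
    separation of points, serves to measure the diagonal. *)
Lemma standard_borel_countably_generated (d : measure_display)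
    (T : measurableType d) : standard_borel R T ->
  exists U : nat -> set T, [/\ forall n, measurable (U n),
    forall A, measurable A -> <<s range U>> A &
    forall x y, (forall n, U n x -> U n y) -> x = y].
Proof.
move=> [P polP [f [g [mf mg fK gK]]]].
have [V oV baseV] := polish_countable_base polP.
have mV n : measurable (V n : set (borel P)).
  by apply: sub_sigma_algebra; exact: oV.
exists (fun n => f @^-1` V n); split.
- by move=> n; rewrite -[X in measurable X]setTI; exact: mf.
(* On [T] with the sigma-field generated by the [U n], [f] is still measurable because the base
   generates the Borel sets; every [A] is the [f]-preimage of a Borel set. *)
- pose TU := g_sigma_algebraType (range (fun n => f @^-1` V n)).
  have mfU : measurable_fun [set: TU] (f : TU -> borel P).
    apply: (@measurability _ _ TU (borel P) _ _ (range V)).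
      rewrite eqEsubset; split.
        apply: smallest_sub; first exact: smallest_sigma_algebra.
        move=> O oO.
        (* Base sets not contained in [O] are replaced by [set0], so that the union runs over all of
           [nat]. *)
        have -> : O = \bigcup_n (if asbool (V n `<=` O) then V n else set0).
          rewrite eqEsubset; split => [p Op|p [n _]].
            have [n [Vp VO]] := baseV O p oO Op.
            by exists n => //; case: asboolP.
          by case: asboolP => // VO /VO.
        apply: sigma_algebra_bigcup => n; case: asboolP => _.
          by apply: sub_sigma_algebra; exists n.
        exact: sigma_algebra0.
      apply: smallest_sub; first exact: smallest_sigma_algebra.
      by move=> _ [n _ <-]; exact: mV.
    move=> _ [_ [n _ <-] <-]; rewrite setTI; apply: sub_sigma_algebra.
    by exists n.
  move=> A mA.
  have -> : A = f @^-1` (g @^-1` A) by apply/seteqP; split=> x /=; rewrite fK.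
  rewrite -[X in <<s _ >> X]setTI; apply: mfU => //.
  by rewrite -[X in measurable X]setTI; exact: mg.
- move=> x y xy; rewrite -[x]fK -[y]fK; congr g.
  apply: contrapT => /eqP fxy.
  have [hP _] := polP; move: hP; rewrite open_hausdorff => /(_ _ _ fxy).
  move=> [[A B] /= [/[!inE] Ax By] [oA oB AB0]].
  have [n [/xy Vy VA]] := baseV A _ oA Ax.
  have : (A `&` B) (f y) by split => //; exact: VA.
  by rewrite AB0.
Qed.

(** The [n]-th set of the intersection below consists of the pairs with [U n x -> U n y]; by
    separation, all these conditions together force equality. *)
Lemma measurable_diagonal (d : measure_display) (T : measurableType d) :
  standard_borel R T -> measurable [set z : T * T | z.1 = z.2].
Proof.
move=> /standard_borel_countably_generated[U [mU _ Usep]].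
have -> : [set z : T * T | z.1 = z.2] =
    \bigcap_n ((~` U n `*` setT) `|` (setT `*` U n)).
  rewrite eqEsubset; split => [[x y] /= -> n _ /=|[x y] /= xy].
    by have [Uy|Uy] := pselect (U n y); [right|left].
  by apply: Usep => n Ux; have [[]|[]] := xy n I.
apply: bigcapT_measurable => n; apply: measurableU; apply: measurableX => //.
exact: measurableC.
Qed.

End standard_borel.

(** * Hahn-Jordan decomposition and the maximal coupling of two measures *)

Section maximal_coupling.
Context {d : measure_display} {T : measurableType d} {R : realType}.
Implicit Types P Q : probability T R.
Local Open Scope ereal_scope.
Local Open Scope charge_scope.

Definition difference P Q : {charge set T -> \bar R} :=
  cadd (charge_of_finite_measure P) (copp (charge_of_finite_measure Q)).

Lemma differenceE P Q A : difference P Q A = P A - Q A.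
Proof. by []. Qed.

(** The set is chosen for each pair separately, so nothing is known of its dependence on [P] and
    [Q]; measurability goes through [excess_sup] instead. *)
Definition hahn_pos P Q : set T :=
  sval (cid (Hahn_decomposition (difference P Q))).

Definition hahn_neg P Q : set T :=
  sval (cid (svalP (cid (Hahn_decomposition (difference P Q))))).

Lemma hahn_posneg P Q :
  hahn_decomposition (difference P Q) (hahn_pos P Q) (hahn_neg P Q).
Proof. exact: svalP (cid (svalP (cid _))). Qed.

Lemma measurable_hahn_pos P Q : measurable (hahn_pos P Q).
Proof. by have [[]] := hahn_posneg P Q. Qed.

Lemma measurable_hahn_neg P Q : measurable (hahn_neg P Q).
Proof. by have [_ []] := hahn_posneg P Q. Qed.

(** This is the Jordan part (P - Q)^+, and [deficit] is (P - Q)^-. *)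
Definition excess P Q : {finite_measure set T -> \bar R} :=
  jordan_pos (hahn_posneg P Q).

Definition deficit P Q : {finite_measure set T -> \bar R} :=
  jordan_neg (hahn_posneg P Q).

(** The smaller of the two measures on each Hahn set, hence a measure by construction; [meetE] gives
    the form P - (P - Q)^+. *)
Definition meet P Q : {measure set T -> \bar R} :=
  measure_add (mrestr P (measurable_hahn_neg P Q))
              (mrestr Q (measurable_hahn_pos P Q)).

Lemma meet_def P Q A :
  meet P Q A = P (A `&` hahn_neg P Q) + Q (A `&` hahn_pos P Q).
Proof. exact: measure_addE. Qed.

Let fP P A : measurable A -> P A \is a fin_num.
Proof. by move=> mA; rewrite fin_num_measure. Qed.

Lemma excessE P Q A : measurable A ->
  excess P Q A = P (A `&` hahn_pos P Q) - Q (A `&` hahn_pos P Q).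
Proof. by move=> mA; rewrite /excess /= jordan_posE /= /crestr0 mem_set. Qed.

Lemma deficitE P Q A : measurable A ->
  deficit P Q A = Q (A `&` hahn_neg P Q) - P (A `&` hahn_neg P Q).
Proof.
move=> mA; rewrite /deficit /= jordan_negE cjordan_negE /= /crestr0 mem_set //.
rewrite /crestr differenceE.
have mAN := measurableI _ _ mA (measurable_hahn_neg P Q).
by rewrite fin_num_oppeB ?fP // addeC.
Qed.

Let split_hahn P Q (mu : probability T R) A : measurable A ->
  mu (A `&` hahn_pos P Q) + mu (A `&` hahn_neg P Q) = mu A.
Proof.
move=> mA; have [_ _ PN1 PN0] := hahn_posneg P Q.
rewrite -measureU -?setIUr ?PN1 ?setIT //.
- exact: measurableI (measurable_hahn_pos P Q).
- exact: measurableI (measurable_hahn_neg P Q).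
- by rewrite setIACA PN0 setI0.
Qed.

Lemma meet_excess P Q A : measurable A -> meet P Q A + excess P Q A = P A.
Proof.
move=> mA; rewrite excessE // meet_def.
have mAP := measurableI _ _ mA (measurable_hahn_pos P Q).
rewrite -addeA [X in _ + X]addeC subeK ?fP // addeC.
exact: split_hahn.
Qed.

Lemma meet_deficit P Q A : measurable A -> meet P Q A + deficit P Q A = Q A.
Proof.
move=> mA; rewrite deficitE // meet_def.
have mAN := measurableI _ _ mA (measurable_hahn_neg P Q).
rewrite [X in X + _]addeC -addeA [X in _ + X]addeC subeK ?fP //.
exact: split_hahn.
Qed.

Let fexc P Q A : measurable A -> excess P Q A \is a fin_num.
Proof. by move=> mA; rewrite fin_num_measure. Qed.

Lemma meetE P Q A : measurable A -> meet P Q A = P A - excess P Q A.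
Proof. by move=> mA; rewrite -(meet_excess P Q mA) addeK ?fexc. Qed.

(** Eliminates the Hahn sets, so that measurability of the deficit reduces to that of the excess. *)
Lemma deficit_sub P Q A : measurable A ->
  deficit P Q A = Q A - (P A - excess P Q A).
Proof.
move=> mA; rewrite -(meet_deficit P Q mA) -meetE // addeAC subee ?add0e //.
by rewrite meetE // fin_numB fP // fexc.
Qed.

Lemma deficit_setT P Q : deficit P Q [set: T] = excess P Q [set: T].
Proof.
rewrite deficit_sub // !probability_setT fin_num_oppeB ?fexc //.
by rewrite addeA subee // add0e.
Qed.

(** On the intersection, [P] is [meet] plus [excess] and [meet] is below [Q]; then [excess] is
    monotone. *)
Lemma excess_ge P Q A B : measurable A -> measurable B ->
  P (A `&` B) - Q (A `&` B) <= excess P Q A.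
Proof.
move=> mA mB; have mAB := measurableI _ _ mA mB.
apply: (@le_trans _ _ (excess P Q (A `&` B))); last first.
  by apply: le_measure; rewrite ?inE//; exact: subIsetl.
rewrite leeBlDr ?fP // -(meet_excess P Q mAB) addeC leeD2l//.
by rewrite -(meet_deficit P Q mAB) leeDl.
Qed.

(** As [meet] is below both measures, either difference is at most the common mass of [excess] and
    [deficit]; the positive Hahn set attains it. *)
Lemma tv_distE P Q : tv_dist P Q = excess P Q [set: T].
Proof.
apply/eqP; rewrite eq_le; apply/andP; split.
- apply: ge_ereal_sup => _ [A mA <-].
  have mle : forall P', P' A = P A \/ P' A = Q A -> meet P Q A <= P' A.
    move=> P' [|] ->; first by rewrite -(meet_excess P Q mA) leeDl.
    by rewrite -(meet_deficit P Q mA) leeDl.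
  have [PQ|/ltW PQ] := leP 0 (P A - Q A);
    [rewrite gee0_abs //|rewrite lee0_abs //].
  + rewrite leeBlDr ?fP // -(meet_excess P Q mA) addeC; apply: leeD.
      by apply: le_measure; rewrite ?inE.
    by apply: mle; right.
  + rewrite fin_num_oppeB ?fP // addeC leeBlDr ?fP //.
    rewrite -(meet_deficit P Q mA) addeC -deficit_setT; apply: leeD.
      by apply: le_measure; rewrite ?inE.
    by apply: mle; left.
- apply: ereal_sup_ubound; exists (hahn_pos P Q).
    exact: measurable_hahn_pos.
  rewrite excessE // setTI gee0_abs //.
  have [[_ +] _ _ _] := hahn_posneg P Q; apply => //.
  exact: measurable_hahn_pos.
Qed.

Let mdiag : measurable_fun [set: T] (fun x => (x, x)).
Proof. exact: measurable_fun_pair. Qed.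

Definition diagonal_meet P Q : set (T * T) -> \bar R :=
  pushforward (meet P Q) (fun x => (x, x)).

Let diagonal_meet0 P Q : diagonal_meet P Q set0 = 0.
Proof. exact: measure0. Qed.

Let diagonal_meet_ge0 P Q A : 0 <= diagonal_meet P Q A.
Proof. exact: measure_ge0. Qed.

Let diagonal_meet_sigma_additive P Q : semi_sigma_additive (diagonal_meet P Q).
Proof. exact: measure_semi_sigma_additive. Qed.

HB.instance Definition _ P Q := isMeasure.Build _ _ _ (diagonal_meet P Q)
  (diagonal_meet0 P Q) (diagonal_meet_ge0 P Q)
  (@diagonal_meet_sigma_additive P Q).

Let excess_mass_inv_ge0 P Q : (0 <= (fine (excess P Q [set: T]))^-1)%R.
Proof. by rewrite invr_ge0 fine_ge0. Qed.

Definition excess_mass_inv P Q : {nonneg R} := NngNum (excess_mass_inv_ge0 P Q).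

(* If P = Q the excess vanishes and the factor is 0^-1 = 0. *)
Definition maximal_coupling_fun P Q : set (T * T) -> \bar R :=
  measure_add (diagonal_meet P Q)
    (mscale (excess_mass_inv P Q) (excess P Q \x deficit P Q)).

HB.instance Definition _ P Q := Measure.on (maximal_coupling_fun P Q).

Lemma maximal_coupling_funE P Q (B : set (T * T)) :
  maximal_coupling_fun P Q B = meet P Q [set x | B (x, x)] +
    (fine (excess P Q [set: T]))^-1%:E * (excess P Q \x deficit P Q) B.
Proof. exact: measure_addE. Qed.

(** If the total mass is 0, then [z] is squeezed to 0 and the convention for the inverse of 0 does
    no harm. *)
Let mass_cancel P Q (z : \bar R) : 0 <= z <= excess P Q [set: T] ->
  (fine (excess P Q [set: T]))^-1%:E * (z * excess P Q [set: T]) = z.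
Proof.
rewrite -(fineK (fexc P Q measurableT)).
set t := fine _ => /andP[z0 zt]; have [t0|t0] := eqVneq t 0%R.
  by move: zt; rewrite t0 mule0 mule0 => zt; apply/eqP; rewrite eq_le zt z0.
by rewrite muleC -muleA -EFinM divff // mule1.
Qed.

Let excess_deficit_rect P Q A B : measurable A -> measurable B ->
  (excess P Q \x deficit P Q) (A `*` B) = excess P Q A * deficit P Q B.
Proof. exact: product_measure1E. Qed.

Lemma maximal_coupling_rect P Q A B : measurable A -> measurable B ->
  maximal_coupling_fun P Q (A `*` B) = meet P Q (A `&` B) +
    (fine (excess P Q [set: T]))^-1%:E * (excess P Q A * deficit P Q B).
Proof. by move=> mA mB; rewrite maximal_coupling_funE excess_deficit_rect. Qed.

(** The second factor has the same total mass as the first, so normalization turns the product term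
    into [excess P Q A]. *)
Lemma maximal_coupling_fst P Q A : measurable A ->
  maximal_coupling_fun P Q (A `*` [set: T]) = P A.
Proof.
move=> mA; rewrite maximal_coupling_rect // setIT deficit_setT mass_cancel.
  exact: meet_excess.
by rewrite measure_ge0 /=; apply: le_measure; rewrite ?inE.
Qed.

Lemma maximal_coupling_snd P Q A : measurable A ->
  maximal_coupling_fun P Q ([set: T] `*` A) = Q A.
Proof.
move=> mA; rewrite maximal_coupling_rect // setTI
  [excess P Q _ * _]muleC mass_cancel.
  exact: meet_deficit.
rewrite measure_ge0 /= -deficit_setT; apply: le_measure; rewrite ?inE//.
Qed.

Let maximal_coupling_setT P Q : maximal_coupling_fun P Q [set: T * T] = 1.
Proof. by rewrite -setXTT maximal_coupling_fst // probability_setT. Qed.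

HB.instance Definition _ P Q := Measure_isProbability.Build _ _ _
  (maximal_coupling_fun P Q) (maximal_coupling_setT P Q).

Definition maximal_coupling P Q : probability (T * T)%type R :=
  maximal_coupling_fun P Q.

Lemma is_coupling_maximal P Q : is_coupling P Q (maximal_coupling P Q).
Proof.
by split=> A mA; [exact: maximal_coupling_fst|exact: maximal_coupling_snd].
Qed.

(** The diagonal is covered by two rectangles, each null because [excess] vanishes off the positive
    Hahn set and [deficit] vanishes on it. *)
Let product_diagonal P Q : measurable [set z : T * T | z.1 = z.2] ->
  (excess P Q \x deficit P Q) [set z : T * T | z.1 = z.2] = 0.
Proof.
move=> mD; have mH := measurable_hahn_pos P Q; have mHC := measurableC mH.
have [_ _ _ PN0] := hahn_posneg P Q.
have e0 : excess P Q (~` hahn_pos P Q) = 0.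
  by rewrite excessE // setICl !measure0 sube0.
have d0 : deficit P Q (hahn_pos P Q) = 0.
  by rewrite deficitE // PN0 !measure0 sube0.
apply/eqP; rewrite eq_le measure_ge0 andbT.
have mX : measurable (~` hahn_pos P Q `*` [set: T]) by exact: measurableX.
have mY : measurable ([set: T] `*` hahn_pos P Q) by exact: measurableX.
apply: (@le_trans _ _ ((excess P Q \x deficit P Q)
    (~` hahn_pos P Q `*` [set: T] `|` [set: T] `*` hahn_pos P Q))).
  apply: le_measure; rewrite ?inE //; first exact: measurableU.
  move=> [x y] /= ->; have [Hy|Hy] := pselect (hahn_pos P Q y).
    by right.
  by left.
have <- : (excess P Q \x deficit P Q) (~` hahn_pos P Q `*` [set: T]) +
    (excess P Q \x deficit P Q) ([set: T] `*` hahn_pos P Q) = 0.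
  by rewrite !excess_deficit_rect // e0 d0 mul0e mule0 adde0.
exact: measureU2.
Qed.

(** The integrand is the indicator of the off-diagonal set, where [meet] puts no mass and the scaled
    product puts all of its own. *)
Lemma integral_upsilon_maximal P Q : measurable [set z : T * T | z.1 = z.2] ->
  \int[maximal_coupling P Q]_z (upsilon R z.1 z.2)%:E = tv_dist P Q.
Proof.
move=> mD; have mDC := measurableC mD.
rewrite (eq_integral
  (fun z => (\1_(~` [set z : T * T | z.1 = z.2]) z)%:E)); last first.
  move=> [x y] _; rewrite indicE in_setC /upsilon /=.
  case: (eqVneq x y) => [->|xy]; first by rewrite mem_set.
  by rewrite memNset//; exact/eqP.
rewrite integral_indic // setIT tv_distE.
transitivity (maximal_coupling_fun P Q (~` [set z : T * T | z.1 = z.2])).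
  by [].
rewrite maximal_coupling_funE (_ : [set x | _] = set0); last first.
  by apply/seteqP; split => x //= /(_ erefl).
have : (excess P Q \x deficit P Q) ([set z : T * T | z.1 = z.2] `|`
      ~` [set z : T * T | z.1 = z.2]) =
    (excess P Q \x deficit P Q) [set z : T * T | z.1 = z.2] +
    (excess P Q \x deficit P Q) (~` [set z : T * T | z.1 = z.2]).
  by apply: measureU => //; exact: setICr.
rewrite setUv product_diagonal // add0e => <-.
rewrite measure0 add0e -setXTT excess_deficit_rect // deficit_setT.
by rewrite mass_cancel // measure_ge0 lexx.
Qed.

End maximal_coupling.

(** * Measurable dependence of the coupling on a parameter *)

Section measurability.
Context {d : measure_display} {T : measurableType d} {R : realType}.
Local Open Scope ereal_scope.

(** Approximation under P + Q controls the errors under both measures with a single index. *)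
Definition sum_measure_fun (P Q : probability T R) := measure_add P Q.

HB.instance Definition _ P Q := Measure.on (sum_measure_fun P Q).

Let sum_measure_fun_fin P Q : fin_num_fun (sum_measure_fun P Q).
Proof.
move=> A mA.
by rewrite /sum_measure_fun measure_addE fin_numD !fin_num_measure.
Qed.

HB.instance Definition _ P Q :=
  Measure_isFinite.Build _ _ _ (sum_measure_fun P Q) (@sum_measure_fun_fin P Q).

Definition sum_measure P Q : {finite_measure set T -> \bar R} :=
  sum_measure_fun P Q.

Lemma sum_measureE P Q A : sum_measure P Q A = P A + Q A.
Proof. exact: measure_addE. Qed.

(* The positive Hahn set is approximated by the countable algebra with respect
   to P + Q, so the countable supremum is not smaller than the excess. *)
Lemma excess_sup (U : nat -> set T) (P Q : probability T R) A :
  (forall n, measurable (U n)) -> (forall B, measurable B -> <<s range U>> B) ->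
  measurable A ->
  excess P Q A = ereal_sup (range (fun n =>
    P (A `&` generated_algebra U n) - Q (A `&` generated_algebra U n))).
Proof.
move=> mU genU mA; have mG := measurable_generated_algebra mU.
have mH := measurable_hahn_pos P Q.
have fin (mu : probability T R) B : measurable B -> mu B \is a fin_num.
  by move=> mB; rewrite fin_num_measure.
pose G := generated_algebra U.
apply/eqP; rewrite eq_le; apply/andP; split; last first.
  by apply: ge_ereal_sup => _ [n _ <-]; exact: excess_ge.
apply/lee_addgt0Pr => e e0.
have [n] := generated_algebra_approx mU (sum_measure P Q) (genU _ mH) e0.
rewrite -/G !sum_measureE.
set H := hahn_pos P Q in mH * => ne.
have PH : P (A `&` H) <= P (A `&` G n) + P (H `\` G n).
  apply: le_trans (measureU2 _ _ _); [|exact: measurableI|exact: measurableD].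
  apply: le_measure; rewrite ?inE; first exact: measurableI.
    by apply: measurableU; [exact: measurableI|exact: measurableD].
  by move=> x [Ax Hx]; have [Gx|Gx] := pselect (G n x); [left|right].
have QH : Q (A `&` G n) <= Q (A `&` H) + Q (G n `\` H).
  apply: le_trans (measureU2 _ _ _); [|exact: measurableI|exact: measurableD].
  apply: le_measure; rewrite ?inE; first exact: measurableI.
    by apply: measurableU; [exact: measurableI|exact: measurableD].
  by move=> x [Ax Gx]; have [Hx|Hx] := pselect (H x); [left|right].
(* Of the four terms in the (P + Q)-mass of the symmetric difference, only these two enter. *)
have PQe : P (H `\` G n) + Q (G n `\` H) <= e%:E.
  by apply: le_trans (ltW ne); apply: leeD; [exact: leeDl|exact: leeDr].
have mAG : measurable (A `&` G n) by exact: measurableI.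
have mAH : measurable (A `&` H) by exact: measurableI.
apply: (@le_trans _ _ (P (A `&` G n) - Q (A `&` G n) + e%:E)); last first.
  by rewrite leeD2r//; apply: ereal_sup_ubound; exists n.
rewrite excessE // -/H; move: PH QH PQe.
have mHG : measurable (H `\` G n) by exact: measurableD.
have mGH : measurable (G n `\` H) by exact: measurableD.
rewrite -(fineK (fin P _ mAH)) -(fineK (fin P _ mAG)) -(fineK (fin P _ mHG)).
rewrite -(fineK (fin Q _ mAH)) -(fineK (fin Q _ mAG)) -(fineK (fin Q _ mGH)).
by rewrite -!EFinB -!EFinD !lee_fin; lra.
Qed.

Context {d' : measure_display} {Y : measurableType d'}.
Context (P Q : Y -> probability T R).
Hypothesis Tstd : standard_borel R T.
Hypothesis mP : forall A, measurable A -> measurable_fun [set: Y] (P ^~ A).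
Hypothesis mQ : forall A, measurable A -> measurable_fun [set: Y] (Q ^~ A).

Lemma measurable_excess A : measurable A ->
  measurable_fun [set: Y] (fun y => excess (P y) (Q y) A).
Proof.
move=> mA; have [U [mU genU _]] := standard_borel_countably_generated Tstd.
have mG := measurable_generated_algebra mU.
pose f n y :=
  P y (A `&` generated_algebra U n) - Q y (A `&` generated_algebra U n).
(* The tail supremum from index 0 is the supremum of the whole sequence. *)
rewrite (_ : (fun y => _) = (fun y => esups (f ^~ y) 0%N)).
  apply: measurable_fun_esups => n; apply: emeasurable_funB.
    by apply: mP; exact: measurableI.
  by apply: mQ; exact: measurableI.
apply/funext => y; rewrite (excess_sup _ _ mU genU mA) /esups /sdrop /=.
by congr ereal_sup; apply/seteqP; split => _ [n _ <-]; exists n.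
Qed.

Lemma measurable_deficit A : measurable A ->
  measurable_fun [set: Y] (fun y => deficit (P y) (Q y) A).
Proof.
move=> mA; under eq_fun do rewrite deficit_sub //.
apply: emeasurable_funB; first exact: mQ.
by apply: emeasurable_funB; [exact: mP|exact: measurable_excess].
Qed.

Lemma measurable_meet A : measurable A ->
  measurable_fun [set: Y] (fun y => meet (P y) (Q y) A).
Proof.
move=> mA; under eq_fun do rewrite meetE //.
by apply: emeasurable_funB; [exact: mP|exact: measurable_excess].
Qed.

(** Dynkin's theorem reduces to rectangles, where the coupling is an explicit expression in [meet],
    [excess] and [deficit]. *)
Lemma measurable_maximal_coupling B : measurable B ->
  measurable_fun [set: Y] (fun y => maximal_coupling (P y) (Q y) B).
Proof.
rewrite measurable_prod_measurableType; move: B.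
apply: dynkin_induction => /=.
- by rewrite measurable_prod_measurableType.
- move=> _ _ [A1 mA1 [A2 mA2 <-]] [B1 mB1 [B2 mB2 <-]].
  exists (A1 `&` B1); first exact: measurableI.
  exists (A2 `&` B2); first exact: measurableI.
  by rewrite setXI.
- by under eq_fun do rewrite probability_setT; exact: measurable_cst.
- move=> _ [A mA [B mB <-]].
  under eq_fun do rewrite maximal_coupling_rect //.
  apply: emeasurable_funD; first by apply: measurable_meet; exact: measurableI.
  apply: emeasurable_funM; last first.
    apply: emeasurable_funM; first exact: measurable_excess.
    exact: measurable_deficit.
  apply/measurable_EFinP.
  (* Powers are known to be measurable; on nonnegative reals the power -1 is the inverse, with value
     0 at 0 for both. *)
  rewrite [X in measurable_fun _ X](_ : _ = (fun y =>
      fine (excess (P y) (Q y) [set: T]) `^ (-1))%R); last first.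
    by apply/funext => y; rewrite powR_inv1 // fine_ge0.
  apply: (measurableT_comp (@measurable_powR R (-1)%R)).
  apply: measurableT_comp; first exact: fine_measurable.
  exact: measurable_excess.
- move=> S mS HS.
  under eq_fun do rewrite probability_setC //.
  by apply: emeasurable_funB; [exact: measurable_cst|exact: HS].
- move=> F mF tF Fn.
  apply: (eq_measurable_fun (fun y =>
      \sum_(0 <= k <oo) maximal_coupling (P y) (Q y) (F k))).
    by move=> y _; rewrite measure_semi_bigcup//; exact: bigcup_measurable.
  apply: ge0_emeasurable_sum => n; first by move=> *; exact: measure_ge0.
  by move=> _; exact: Fn.
Qed.

End measurability.

(** * Couplings of one-site specifications *)

Theorem proposition2p3 (R : realType)
    (L : countType) (adj : rel L)
    (adj_simple : simple_graph adj) (adj_connected : connected_graph adj)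
    (d : measure_display) (Xi : measurableType d)
    (Xi_standard : standard_borel R Xi)
    (pi_ : L -> (L -> Xi) -> probability Xi R)
    (pi_spec : one_site_specification pi_) :
  exists rho : L -> (L -> Xi) -> (L -> Xi) -> probability (Xi * Xi)%type R,
    forall l : L,
      [/\ forall x y : L -> Xi, is_coupling (pi_ l x) (pi_ l y) (rho l x y),
          forall B : set (Xi * Xi), measurable B ->
            measurable_fun [set: offsite Xi l * offsite Xi l]
              (fun xy : offsite Xi l * offsite Xi l => rho l xy.1 xy.2 B)
        & forall x y : L -> Xi,
            tv_dist (pi_ l x) (pi_ l y) =
            (\int[rho l x y]_z (upsilon R z.1 z.2)%:E)%E].
Proof.
exists (fun l x y => maximal_coupling (pi_ l x) (pi_ l y)) => l; split.
- by move=> x y; exact: is_coupling_maximal.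
- move=> B mB.
  (* The parameter space is X^2 with F_l^2; both families are the specification composed with a
     measurable projection. *)
  apply: (@measurable_maximal_coupling _ _ _ _
    (offsite Xi l * offsite Xi l)%type
    (fun xy => pi_ l xy.1) (fun xy => pi_ l xy.2)) => // A mA.
  + apply: (@measurableT_comp _ _ _ _ _ _ (fun x : offsite Xi l => pi_ l x A)).
      exact: pi_spec.
    exact: measurable_fst.
  + apply: (@measurableT_comp _ _ _ _ _ _ (fun x : offsite Xi l => pi_ l x A)).
      exact: pi_spec.
    exact: measurable_snd.
- move=> x y; rewrite integral_upsilon_maximal //.
  exact: measurable_diagonal Xi_standard.
Qed.
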